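(* Both of the following hold. (1) Let $n,c$ be positive integers with $c\le n-2$. If $G$ is a graph of order $n$ and vertex connectivity $c$, and $G$ is not isomorphic to $G_{n,c}$, then $$\eta(G) < \eta(G_{n,c}).$$ (2) Let $n,e$ be positive integers with $e<n-1$. If $G$ is a graph of order $n$ and edge connectivity $e$, and $G$ is not isomorphic to $G_{n,e}$, then $$\eta(G) < \eta(G_{n,e}).$$
   Context: All graphs are finite and simple (undirected, no loops or multiple edges). The order of $G$ is $|V(G)|$. For a graph $G$, $\eta(G)$ denotes the number of connected induced subgraphs of $G$, i.e. the number of nonempty subsets $S\subseteq V(G)$ such that the subgraph of $G$ induced by $S$ is connected. The vertex connectivity of $G$ is the minimum size of a set $S$ of vertices such that $G-S$ has more components than $G$. The edge connectivity of $G$ is the minimum size of a set $S$ of edges such that $G-S$ has more components than $G$. For positive integers $n,x$ with $x\le n-2$, the graph $G_{n,x}$ is obtained by taking one copy of the complete graph $K_{n-1}$ and adding one further vertex that is adjacent to exactly $x$ vertices of $K_{n-1}$. *)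

(* Defs.v *)
From mathcomp Require Import all_boot.

Set Implicit Arguments.
Unset Strict Implicit.
Unset Printing Implicit Defensive.

Record sgraph := SGraph {
  vertex :> finType;
  adj : rel vertex;
  adj_sym : symmetric adj;
  adj_irr : irreflexive adj
}.

Definition isomorphic (G H : sgraph) : Prop :=
  exists2 f : G -> H, bijective f & forall u v, adj (f u) (f v) = adj u v.

Section Subgraphs.
Variable G : sgraph.

Section Induced.
Variable S : {set G}.

Definition induced_adj : rel {v : G | v \in S} :=
  fun u v => adj (val u) (val v).

Lemma induced_adj_sym : symmetric induced_adj.
Proof. by move=> u v; apply: adj_sym. Qed.

Lemma induced_adj_irr : irreflexive induced_adj.
Proof. by move=> u; apply: adj_irr. Qed.

Definition induced : sgraph := SGraph induced_adj_sym induced_adj_irr.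

End Induced.

Definition edges : {set {set G}} :=
  [set [set u; v] | u in G, v in G & adj u v].

Section DeleteEdges.
Variable F : {set {set G}}.

Definition delete_edges_adj : rel G :=
  fun u v => adj u v && ([set u; v] \notin F).

Lemma delete_edges_adj_sym : symmetric delete_edges_adj.
Proof. by move=> u v; rewrite /delete_edges_adj adj_sym setUC. Qed.

Lemma delete_edges_adj_irr : irreflexive delete_edges_adj.
Proof. by move=> u; rewrite /delete_edges_adj adj_irr. Qed.

Definition delete_edges : sgraph :=
  SGraph delete_edges_adj_sym delete_edges_adj_irr.

End DeleteEdges.

Definition delete_vertices (S : {set G}) : sgraph := induced (~: S).

End Subgraphs.

Definition num_components (G : sgraph) : nat := n_comp (@adj G) G.

Definition connected (G : sgraph) : bool :=
  [forall u : G, forall v : G, connect (@adj G) u v].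

(* The empty graph satisfies [connected], hence the explicit [S != set0]. *)
Definition eta (G : sgraph) : nat :=
  #|[set S : {set G} | (S != set0) && connected (induced S)]|.

Definition vertex_cut (G : sgraph) (S : {set G}) : bool :=
  num_components G < num_components (delete_vertices S).

Definition edge_cut (G : sgraph) (F : {set {set G}}) : bool :=
  (F \subset edges G) && (num_components G < num_components (delete_edges F)).

(* The connectivities are relations between a graph and a number: the minimum
   is over an empty family, hence undefined, when every component of [G] is
   complete (vertex connectivity) or [G] has no edge (edge connectivity).
   [G] itself need not be connected. *)
Definition has_vertex_connectivity (G : sgraph) (c : nat) : Prop :=
  (exists2 S : {set G}, vertex_cut S & #|S| = c) /\
  (forall S : {set G}, vertex_cut S -> c <= #|S|).

Definition has_edge_connectivity (G : sgraph) (e : nat) : Prop :=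
  (exists2 F : {set {set G}}, edge_cut F & #|F| = e) /\
  (forall F : {set {set G}}, edge_cut F -> e <= #|F|).

Section Gnx.
Variables n x : nat.

(* [Some i] ranges over the vertices of K_(n-1) and [None] is the further
   vertex, adjacent to the first [x] vertices of K_(n-1). This is the intended
   graph, of order [n] and with exactly [x] such vertices, when [x <= n - 2]
   and [0 < n]. *)
Definition Gnx_adj : rel (option 'I_n.-1) := fun u v =>
  match u, v with
  | Some i, Some j => i != j
  | Some i, None | None, Some i => i < x
  | None, None => false
  end.

Lemma Gnx_adj_sym : symmetric Gnx_adj.
Proof. by move=> [i|] [j|] //=; rewrite eq_sym. Qed.

Lemma Gnx_adj_irr : irreflexive Gnx_adj.
Proof. by move=> [i|] //=; rewrite eqxx. Qed.

Definition Gnx : sgraph := SGraph Gnx_adj_sym Gnx_adj_irr.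

End Gnx.

(* Main.v *)
Require Import Defs.
From mathcomp Require Import all_boot.
From mathcomp Require Import zify.

Set Implicit Arguments.
Unset Strict Implicit.
Unset Printing Implicit Defensive.

(**
  Since 2^n is fixed, it suffices to count the vertex sets inducing a
  disconnected subgraph. If A and B are disjoint nonempty sets, of sizes a and
  b, with no edge in between, then the sets contained in A :|: B that meet both
  A and B are disconnected, and there are (2^a - 1)(2^b - 1) of them, which is
  at least 2^(a + b - 1) - 1, with equality iff a = 1 or b = 1. In G_{n,x} the
  number of disconnected sets is at most 2^(n - x - 1) - 1. So if
  n <= a + b + x, then G has more disconnected sets than G_{n,x} unless
  a = 1 or b = 1, n = a + b + x and all nonadjacent pairs lie across A and B,
  that is, unless G is G_{n,x}.
  A vertex cut of size x yields such A and B at once. For an edge cut of size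
  x < n - 1, separating the vertices into two sides, some pair u, w of vertices
  on opposite sides is nonadjacent, because there are at least n - 1 pairs
  across; deleting from each edge of the cut an endpoint other than u and w
  leaves two nonempty sides with no edge in between.
*)

(** * Disconnected vertex sets *)

Definition disconnected_sets (G : sgraph) : {set {set G}} :=
  [set X | ~~ connected (@induced G X)].

Definition separated (G : sgraph) (A B : {set G}) : Prop :=
  [disjoint A & B] /\ {in A & B, forall x y, ~~ adj x y}.

(** The successor accounts for the empty set: it is connected, but [eta] leaves it out. *)
Lemma eta_disconnected (G : sgraph) :
  (eta G + #|disconnected_sets G|).+1 = 2 ^ #|G|.
Proof.
have conn0 : connected (@induced G set0).
  by apply/forallP=> -[u u0]; exfalso; rewrite inE in u0.
have -> : eta G = #|~: disconnected_sets G :\ set0|.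
  by apply: eq_card => X; rewrite !inE negbK.
rewrite -cardsT -card_powerset powersetT cardsT -addSn -add1n.
have -> : 1 = (set0 \in ~: disconnected_sets G) by rewrite !inE conn0.
by rewrite -cardsD1 addnC cardsC.
Qed.

(** Otherwise [w] would be a hub adjacent to all the rest of [X], and any two vertices would be
    joined through it. *)
Lemma disconnected_nonadjacent (G : sgraph) (X : {set G}) (w : G) :
  X \in disconnected_sets G -> w \in X ->
  exists2 z, z \in X & (z != w) && ~~ adj w z.
Proof.
rewrite inE => nconn wX; apply/exists_inP; apply: contraNT nconn.
rewrite negb_exists_in => /forall_inP hub.
pose w' : induced X := Sub w wX.
have hub' (z : induced X) : connect (@adj (induced X)) w' z.
  have := hub (val z) (valP z); rewrite negb_and !negbK.
  case/orP=> [/eqP zw | wz]; last exact: connect1.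
  by have -> : w' = z by apply: val_inj.
apply/forallP=> u; apply/forallP=> v; apply: connect_trans (hub' v).
by rewrite (sym_connect_sym (@adj_sym _)).
Qed.

(** * Sets meeting both sides of a separated pair *)

Definition straddling (T : finType) (A B : {set T}) : {set {set T}} :=
  [set p.1 :|: p.2 | p in setX (powerset A :\ set0) (powerset B :\ set0)].

Lemma card_straddling (T : finType) (A B : {set T}) :
  [disjoint A & B] -> #|straddling A B| = (2 ^ #|A| - 1) * (2 ^ #|B| - 1).
Proof.
move=> dAB; rewrite card_in_imset => [|[X Y] [X' Y']].
  by rewrite cardsX !cardsDS ?cards1 ?card_powerset // sub1set inE sub0set.
(* The traces on [A] and [B] recover the pair from its union, which gives injectivity. *)
have restrict (U V : {set T}) : U \subset A -> V \subset B ->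
    ((U :|: V) :&: A = U) * ((U :|: V) :&: B = V).
  move=> sU sV; rewrite !setIUl (setIidPl sU) (setIidPl sV).
  rewrite (disjoint_setI0 (disjointWl sU dAB)) set0U.
  by rewrite (disjoint_setI0 (disjointWl sV _)) ?setU0 // disjoint_sym.
rewrite !inE /= => /andP[/andP[_ sX] /andP[_ sY]].
move=> /andP[/andP[_ sX'] /andP[_ sY']] /= eqU.
have [rX rY] := restrict _ _ sX sY; have [rX' rY'] := restrict _ _ sX' sY'.
by congr (_, _); [rewrite -rX eqU rX' | rewrite -rY eqU rY'].
Qed.

Lemma straddling_disconnected (G : sgraph) (A B : {set G}) :
  separated A B -> straddling A B \subset disconnected_sets G.
Proof.
case=> dAB nAB; apply/subsetP=> Z /imsetP[[X Y]]; rewrite !inE /=.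
case/andP=> /andP[/set0Pn[x xX] /subsetP sX] /andP[/set0Pn[y yY] /subsetP sY].
move=> ->; set U := X :|: Y; apply/negP=> /forallP conn.
have xU : x \in U by rewrite inE xX.
have yU : y \in U by rewrite inE yY orbT.
have notA z : z \in Y -> z \in A = false.
  by move=> /sY zB; apply: (disjointFl dAB).
(* No edge of the induced subgraph leaves [A], so no path leads from [x] to [y]. *)
have clA : closed (@induced_adj G U) [pred z | val z \in A].
  move=> [u uU] [v vU]; rewrite /induced_adj !inE /=.
  case/setUP: uU => [/sX uA | uY]; case/setUP: vU => [/sX vA | vY] uv.
  - by rewrite uA vA.
  - by case/negP: (nAB _ _ uA (sY _ vY)).
  - by case/negP: (nAB _ _ vA (sY _ uY)); rewrite adj_sym.
  - by rewrite !notA.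
have := closed_connect clA (forallP (conn (Sub x xU)) (Sub y yU)).
by rewrite !inE /= (sX _ xX) notA.
Qed.

(** Applied to nonadjacent pairs, which are disconnected sets, this locates all non-edges across [A]
    and [B] in the equality case. *)
Lemma straddling_pair (T : finType) (A B : {set T}) (u v : T) :
  [set u; v] \in straddling A B ->
  (u \in A) && (v \in B) || (v \in A) && (u \in B).
Proof.
case/imsetP=> -[X Y]; rewrite !inE /=.
case/andP=> /andP[/set0Pn[x xX] sX] /andP[/set0Pn[y yY] sY] defUV.
have xU : x \in [set u; v] by rewrite defUV inE xX.
have yU : y \in [set u; v] by rewrite defUV inE yY orbT.
have uXY : u \in X :|: Y by rewrite -defUV set21.
have vXY : v \in X :|: Y by rewrite -defUV set22.
have xA := subsetP sX x xX; have yB := subsetP sY y yY.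
case/set2P: xU xA xX => ->; case/set2P: yU yB yY => -> yB yY xA xX.
- case/setUP: vXY => [/(subsetP sX)|/(subsetP sY)] ->; by rewrite ?xA ?yB ?orbT.
- by rewrite xA yB.
- by rewrite xA yB orbT.
- case/setUP: uXY => [/(subsetP sX)|/(subsetP sY)] ->; by rewrite ?xA ?yB ?orbT.
Qed.

(** * Counting in G_{n,x} and recognizing it *)

Lemma card_disconnected_Gnx (n x : nat) :
  #|disconnected_sets (Gnx n x)| <= 2 ^ (n.-1 - x) - 1.
Proof.
pose far : {set Gnx n x} := [set Some i | i : 'I_n.-1 & x <= i].
have card_far : #|far| = n.-1 - x.
  rewrite card_imset; last exact: Some_inj.
  by rewrite -sum1dep_card -(big_geq_mkord x n.-1 xpredT (fun=> 1))
    sum_nat_const_nat muln1.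
rewrite -card_far -card_powerset.
have <- : #|powerset far :\ set0| = #|powerset far| - 1.
  by rewrite cardsDS ?cards1 // sub1set inE sub0set.
apply: leq_trans (leq_imset_card (fun Y => None |: Y) _).
apply: subset_leq_card; apply/subsetP=> X discX.
have [w wX] : exists w, w \in X.
  move: (discX); rewrite inE negb_forall => /existsP[[w wX] _].
  by exists w.
(* Clique vertices are pairwise adjacent, so the non-neighbour that a clique vertex of [X] must have
   can only be [None]. Hence [None] is in [X] and, below, every clique vertex of [X] is in [far]. *)
have NX : None \in X.
  case: w wX => [i|] // /(disconnected_nonadjacent discX)[[j|] //].
  by rewrite /= (inj_eq Some_inj) negbK eq_sym andNb.
have [[j|] // jX /= _] := disconnected_nonadjacent discX NX.
apply/imsetP; exists (X :\ None); last by rewrite setD1K.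
rewrite !inE; apply/andP; split.
  by apply/set0Pn; exists (Some j); rewrite !inE.
apply/subsetP=> -[i|]; rewrite !inE //= => iX.
have [[k|]] := disconnected_nonadjacent discX iX.
  by rewrite /= (inj_eq Some_inj) negbK eq_sym andNb.
by move=> _ /=; rewrite -leqNgt => xi; apply/imsetP; exists i; rewrite ?inE.
Qed.

(* The difference of the two sides is 2 (2^(a - 1) - 1) (2^(b - 1) - 1). *)
Lemma straddling_bound (a b : nat) : 0 < a -> 0 < b ->
  2 ^ (a + b).-1 - 1 <= (2 ^ a - 1) * (2 ^ b - 1) ?= iff (a == 1) || (b == 1).
Proof.
case: a b => // a [] // b _ _; rewrite addSn addnS /= !eqSS !expnS expnD.
have P0 : 0 < 2 ^ a by rewrite expn_gt0.
have Q0 : 0 < 2 ^ b by rewrite expn_gt0.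
(* Restating [a == 0] as [2 ^ a == 1] leaves polynomial arithmetic in the two powers. *)
rewrite -(eqn_exp2l a 0 (isT : 1 < 2)) -(eqn_exp2l b 0 (isT : 1 < 2)) expn0.
split; first by nia.
by apply/eqP/idP; nia.
Qed.

(* The isomorphism sends [v] to [insub] of its index in [enum S ++ enum B]; the
   index of [u] is [n.-1], which [insub] sends to [None]. *)
Lemma isomorphic_Gnx (G : sgraph) (n x : nat) (u : G) (S B : {set G}) :
  #|G| = n -> #|S| = x -> [disjoint S & B] -> u \notin B -> S :|: B = [set~ u] ->
  (forall v w, adj v w =
    (v != w) && ~~ ((v == u) && (w \in B) || (w == u) && (v \in B))) ->
  isomorphic G (Gnx n x).
Proof.
move=> cardG cardS dSB uB SBu adjG; pose s := enum S ++ enum B.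
have mem_s v : (v \in s) = (v != u).
  by rewrite mem_cat !mem_enum -in_setU SBu !inE.
have size_s : size s = n.-1.
  rewrite size_cat -!cardE -cardG -(cardsC1 u) -SBu cardsU.
  by rewrite (disjoint_setI0 dSB) cards0 subn0.
pose f v : Gnx n x := insub (index v s).
have fP v : if v == u then f v = None
            else exists2 i, f v = Some i & val i = index v s.
  have := mem_s v; rewrite -index_mem size_s /f => ltP.
  case: eqP ltP => _ /=; first by move/negbT => nlt; rewrite insubN.
  by move=> lt; exists (Ordinal lt) => //; rewrite (insubT (fun i => i < n.-1) lt).
(* [S], the neighbourhood of [u], is listed first in [s], so it gets exactly the indices below
   [x]. *)
have index_lt v : v != u -> (index v s < x) = (v \notin B).
  move=> vu; have : v \in S :|: B by rewrite SBu !inE.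
  rewrite index_cat mem_enum -cardS cardE inE.
  case: (boolP (v \in S)) => [vS _ | _ /= ->].
    by rewrite index_mem mem_enum vS (disjointFr dSB vS).
  by rewrite ltnNge leq_addr.
exists f.
  apply: inj_card_bij; last first.
    by rewrite card_option card_ord -cardG prednK //; apply/card_gt0P; exists u.
  move=> v w; have := fP v; have := fP w.
  case: eqP => [-> | /eqP wu]; case: eqP => [-> | /eqP vu] //.
  - by move=> -> [i ->].
  - by move=> [i -> _] ->.
  move=> [j -> jE] [i -> iE] [ij]; rewrite -(nth_index u (_ : v \in s)) ?mem_s //.
  by rewrite -iE ij jE nth_index // mem_s.
move=> v w; rewrite adjG; have := fP v; have := fP w.
case: (eqVneq w u) => [-> | wu]; case: (eqVneq v u) => [-> | vu].
- by move=> ->.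
- by move=> -> [i -> iE] /=; rewrite iE index_lt.
- by move=> [i -> iE] -> /=; rewrite eq_sym (negPf wu) iE index_lt // orbF.
move=> [j -> jE] [i -> iE] /=; rewrite andbT -val_eqE iE jE.
by congr (~~ _); apply/eqP/eqP => [/index_inj-> | ->]; rewrite ?mem_s.
Qed.

(** * Comparison with G_{n,x} and the equality case *)

Lemma eta_lt_Gnx (G : sgraph) (n x : nat) (A B : {set G}) :
  x < n - 1 -> #|G| = n -> separated A B -> A != set0 -> B != set0 ->
  n <= #|A| + #|B| + x -> ~ isomorphic G (Gnx n x) -> eta G < eta (Gnx n x).
Proof.
move=> ltxn cardG sepAB A0 B0 leAB niso; have [dAB _] := sepAB.
have cardH : #|Gnx n x| = n by rewrite card_option card_ord prednK //; lia.
have eG := eta_disconnected G; have eH := eta_disconnected (Gnx n x).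
suff: #|disconnected_sets (Gnx n x)| < #|disconnected_sets G|.
  by rewrite cardG in eG; rewrite cardH in eH; lia.
rewrite ltnNge; apply/negP=> le_disc; apply: niso.
move: le_disc => /leq_trans/(_ (card_disconnected_Gnx n x)) le_disc.
have sub := straddling_disconnected sepAB.
have le_str := subset_leq_card sub; rewrite (card_straddling dAB) in le_str.
have gtA : 0 < #|A| by rewrite card_gt0.
have gtB : 0 < #|B| by rewrite card_gt0.
have [bnd bnd_eq] := straddling_bound gtA gtB.
have le_exp := leq_trans bnd (leq_trans le_str le_disc).
have gt_exp : 0 < 2 ^ (#|A| + #|B|).-1 by rewrite expn_gt0.
have : 2 ^ (#|A| + #|B|).-1 <= 2 ^ (n.-1 - x) by lia.
rewrite leq_exp2l // => le_card.
have eq_card : (#|A| + #|B|).-1 = n.-1 - x by lia.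
rewrite eq_card in bnd bnd_eq.
(* With equal exponents the chain of inequalities collapses, so the straddling sets exhaust the
   disconnected ones. *)
have defD : straddling A B = disconnected_sets G.
  by apply/eqP; rewrite eqEcard sub (card_straddling dAB) (leq_trans le_disc).
have adjG v w : adj v w =
    (v != w) && ~~ ((v \in A) && (w \in B) || (w \in A) && (v \in B)).
  have [<- | vw] /= := eqVneq; first by rewrite adj_irr.
  apply/idP/idP => [vw_adj | ].
    apply/negP=> /orP[] /andP[XA XB]; move: (sepAB.2 _ _ XA XB).
      by rewrite vw_adj.
    by rewrite adj_sym vw_adj.
  apply: contraNT => nadj; apply: straddling_pair; rewrite defD inE.
  apply/negP=> /forallP conn.
  pose v' : induced [set v; w] := Sub v (set21 v w).
  pose w' : induced [set v; w] := Sub w (set22 v w).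
  have clv : closed (@adj (induced [set v; w])) (pred1 v').
    move=> [a a_in] [b b_in]; rewrite /= /induced_adj !inE -!val_eqE /= => ab.
    move: a_in b_in ab => /set2P[]-> /set2P[]->; rewrite ?adj_irr //.
      by rewrite (negPf nadj).
    by rewrite adj_sym (negPf nadj).
  have := closed_connect clv (forallP (conn v') w').
  by rewrite !inE eqxx -val_eqE /= eq_sym (negPf vw).
(* The single vertex of [A'] becomes [None], and its [x] neighbours are the vertices outside [A']
   and [B']. *)
have iso (A' B' : {set G}) : [disjoint A' & B'] -> #|A'| = 1 ->
    (#|A'| + #|B'|).-1 = n.-1 - x -> (forall v w, adj v w =
    (v != w) && ~~ ((v \in A') && (w \in B') || (w \in A') && (v \in B'))) ->
    isomorphic G (Gnx n x).
  move=> dAB' /eqP/cards1P[u defA] cardAB adjG'; rewrite {}defA in dAB' cardAB adjG'.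
  have uB : u \notin B' by rewrite -disjoints1.
  have cB : #|[set~ u] :\: B'| = x.
    rewrite cardsDS; first by rewrite cardsC1 cardG; rewrite cards1 in cardAB; lia.
    by apply/subsetP=> v vB; rewrite !inE; apply: contraNneq uB => <-.
  apply: (@isomorphic_Gnx _ _ _ u _ B' cardG cB) => //.
  - by rewrite disjoint_sym -setI_eq0 setIDA setDIl setDv set0I.
  - apply/setP=> v; rewrite !inE; case: (boolP (v \in B')) => //= vB.
      by apply/esym; apply: contraNneq uB => <-.
    by rewrite orbF.
  - by move=> v w; rewrite adjG' !inE.
have : (#|A| == 1) || (#|B| == 1).
  by rewrite -bnd_eq; apply/eqP; lia.
case/orP=> /eqP c1; first exact: (iso A B).
apply: (iso B A) => //; first by rewrite disjoint_sym.
  by rewrite addnC.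
by move=> v w; rewrite adjG orbC; congr (_ && ~~ (_ || _)); rewrite andbC.
Qed.

(** * From cuts to separated pairs *)

Lemma not_connect_of_components (G H : sgraph) :
  0 < #|G| -> num_components G < num_components H ->
  exists x y : H, ~~ connect (@adj H) x y.
Proof.
move=> /card_gt0P[z _] lt.
have symG := sym_connect_sym (@adj_sym G).
have symH := sym_connect_sym (@adj_sym H).
have : 1 < num_components H.
  apply: leq_trans lt; rewrite ltnS; apply/card_gt0P.
  by exists (root (@adj G) z); rewrite !inE roots_root.
case/card_gt1P=> x [y [/andP[/eqP rx _] /andP[/eqP ry _] xy]].
by exists x, y; rewrite -root_connect // rx ry.
Qed.

Lemma vertex_cut_separated (G : sgraph) (S : {set G}) :
  0 < #|G| -> vertex_cut S ->
  exists A B : {set G}, [/\ separated A B, A != set0, B != set0 &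
                            #|G| = #|A| + #|B| + #|S|].
Proof.
move=> G0 /(not_connect_of_components G0)[x [y nxy]].
(* [A] is the component of [x] after deleting [S]; the other side is everything else outside [S]. *)
set e := connect _ in nxy; pose A := [set val z | z in e x].
have disj : [disjoint A & ~: S :\: A] by rewrite -setI_eq0 setIDA setDIl setDv set0I.
have sA : A \subset ~: S by apply/subsetP=> _ /imsetP[z _ ->]; apply: valP.
exists A, (~: S :\: A); split.
- split=> // _ b /imsetP[z xz ->]; rewrite !inE => /andP[bA bS].
  have bS' : b \in ~: S by rewrite inE.
  apply: contraNN bA => zb; apply/imsetP; exists (Sub b bS') => //.
  by apply: connect_trans xz _; apply: connect1.
- by apply/set0Pn; exists (val x); apply/imsetP; exists x; rewrite // inE /e connect0.
- apply/set0Pn; exists (val y); rewrite in_setD (valP y) andbT.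
  by apply/imsetP=> -[z xz /val_inj yz]; case/negP: nxy; rewrite yz.
- by rewrite addnC cardsDS // subnKC ?subset_leq_card // cardsC.
Qed.

Lemma edge_cut_separated (G : sgraph) (F : {set {set G}}) :
  edge_cut F -> #|F| < #|G| - 1 ->
  exists A B : {set G}, [/\ separated A B, A != set0, B != set0 &
                            #|G| <= #|A| + #|B| + #|F|].
Proof.
case/andP=> _ cut ltF.
have G0 : 0 < #|G| by lia.
have [x [y nxy]] := not_connect_of_components G0 cut.
set e := connect _ in nxy; pose C : {set G} := [set z | e x z].
have xC : x \in C by rewrite inE /e connect0.
have yC : y \in ~: C by rewrite !inE.
have crossF u w : u \in C -> w \in ~: C -> adj u w -> [set u; w] \in F.
  rewrite !inE => xu xw uw; apply: contraNT xw => uwF.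
  by apply: connect_trans xu (connect1 _); apply/andP.
have [u uC [w wC nuw]] : exists2 u, u \in C & exists2 w, w \in ~: C & ~~ adj u w.
  have inj : {in setX C (~: C) &, injective (fun p : G * G => [set p.1; p.2])}.
    have neq s t : s \in C -> t \in ~: C -> (s == t = false) * (t == s = false).
      move=> sC tC; suff /negPf st : s != t by rewrite [t == s]eq_sym !st.
      by apply: contraTneq sC => ->; rewrite inE in tC.
    move=> [a b] [a' b'] /setXP[aC bC] /setXP[aC' bC'] /= /setP E.
    move: (E a) (E b); rewrite !inE !eqxx orbT (neq a b') // (neq a' b) // orbF /=.
    by move=> /esym/eqP-> /esym/eqP->.
  (* If all pairs across were adjacent, they would inject into [F], but there are at least
     [#|G| - 1] of them. *)
  have : ~~ (setX C (~: C) \subset [pred p | adj p.1 p.2]).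
    apply/negP=> /subsetP all_adj.
    suff : #|setX C (~: C)| <= #|F|.
      have cC := cardsC C; have c1 : 0 < #|C| by apply/card_gt0P; exists x.
      have c2 : 0 < #|~: C| by apply/card_gt0P; exists y.
      by rewrite cardsX; nia.
    rewrite -(card_in_imset inj); apply/subset_leq_card/subsetP => _ /imsetP[p pC ->].
    by have := all_adj p pC; move: pC; rewrite inE => /andP[]; apply: crossF.
  case/subsetPn=> -[u w]; rewrite inE => /andP[uC wC] nuw.
  by exists u => //; exists w.
(* The default [u] is harmless: [T] discards it. *)
pose g (f : {set G}) := odflt u [pick z in f :\: [set u; w]].
pose T := [set g f | f in F] :\: [set u; w].
have leT : #|T| <= #|F|.
  by apply: leq_trans (leq_imset_card g _); apply/subset_leq_card/subsetDl.
have coverT a b : a \in C -> b \in ~: C -> adj a b -> (a \in T) || (b \in T).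
  move=> aC bC ab; pose f := [set a; b].
  have gT : g f \in [set g f | f in F] by apply: imset_f; apply: crossF.
  have : g f \in f :\: [set u; w].
    (* The choice could fail only for [a = u] and [b = w], which are nonadjacent. *)
    rewrite /g; case: pickP => //= none.
    have bu : b != u by apply: contraTneq uC => <-; rewrite inE in bC.
    have aw : a != w by apply: contraTneq wC => <-; rewrite inE aC.
    have := none a; have := none b; rewrite !inE !eqxx (negPf bu) (negPf aw) orbT /=.
    rewrite ?orbF ?andbT => /negbFE/eqP bw /negbFE/eqP au.
    by rewrite au bw (negPf nuw) in ab.
  rewrite inE => /andP[guw /set2P[] gE].
    by rewrite -gE inE guw gT.
  by rewrite -gE orbC inE guw gT.
exists (C :\: T), (~: C :\: T); split.
- split; first by rewrite -setI_eq0 -setDIl setICr set0D.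
  move=> a b /setDP[aC aT] /setDP[bC bT].
  by apply/negP=> /(coverT _ _ aC bC); rewrite (negPf aT) (negPf bT).
- by apply/set0Pn; exists u; rewrite !in_setD set21.
- by apply/set0Pn; exists w; rewrite !in_setD set22.
(* The vertices lost from the two sides are the parts of [T] in [C] and in [~: C], together [T]
   itself. *)
- rewrite -(cardsC C) -(cardsID T C) -(cardsID T (~: C)) addnACA addnC leq_add2l.
  apply: leq_trans leT; rewrite -(cardsID C T) setDE.
  by rewrite setIC leq_add2l setIC.
Qed.

Theorem theorem2p3 :
  (forall n c : nat, 0 < n -> 0 < c -> c <= n - 2 ->
     forall G : sgraph, #|G| = n -> has_vertex_connectivity G c ->
       ~ isomorphic G (Gnx n c) -> eta G < eta (Gnx n c)) /\
  (forall n e : nat, 0 < n -> 0 < e -> e < n - 1 ->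
     forall G : sgraph, #|G| = n -> has_edge_connectivity G e ->
       ~ isomorphic G (Gnx n e) -> eta G < eta (Gnx n e)).
Proof.
split=> n k n0 k0 lek G cardG [[X cutX cardX] _]; rewrite -cardG -cardX in n0 lek *.
  have [A [B [sepAB A0 B0 cardAB]]] := vertex_cut_separated n0 cutX.
  apply: (eta_lt_Gnx _ _ sepAB) => //; last by rewrite cardAB.
  by rewrite cardX in lek *; lia.
have [A [B [sepAB A0 B0 cardAB]]] := edge_cut_separated cutX lek.
exact: (eta_lt_Gnx _ _ sepAB).
Qed.
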